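(* The set $\mathcal{C}_{\mathrm{CGF}}$ of standardized CGF characteristic functions is a normal family of entire functions; that is, each of its elements is entire, and every sequence in $\mathcal{C}_{\mathrm{CGF}}$ has a subsequence converging uniformly on compact subsets of $\mathbb{C}$.
   Context: $[n]_q=1+q+\cdots+q^{n-1}$. $\Phi^+$ is the set of basic cyclotomic generating functions: polynomials with nonnegative integer coefficients of the form $\prod_{j=1}^m[a_j]_q/[b_j]_q$ for multisets of positive integers. For $f\in\Phi^+$ let $\mathcal{X}$ be the random variable with $\mathbb{E}[q^{\mathcal{X}}]=f(q)/f(1)$, mean $\mu$ and variance $\sigma^2$. If $f$ is non-constant ($\sigma>0$), its standardized characteristic function, extended to $z\in\mathbb{C}$, is $\phi_{\mathcal{X}^*}(z)=e^{-iz\mu/\sigma}f(e^{iz/\sigma})/f(1)$; if $f=1$ it is the constant function $1$. $\mathcal{C}_{\mathrm{CGF}}$ is the set of all such functions $\phi_{\mathcal{X}^*}$ for $f\in\Phi^+$. *)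

(* Defs.v *)
From HB Require Import structures.
From mathcomp Require Import all_boot all_order all_algebra.
From mathcomp Require Import all_classical all_reals all_analysis.
From mathcomp Require Import complex.

Set Implicit Arguments.
Unset Strict Implicit.
Unset Printing Implicit Defensive.

Import Order.TTheory GRing.Theory Num.Theory.
Import numFieldNormedType.Exports.

Local Open Scope classical_set_scope.
Local Open Scope complex_scope.
Local Open Scope ring_scope.

Definition qint (n : nat) : {poly int} := \sum_(i < n) 'X^i.

Local Notation "x %:F" := (tofrac x) : ring_scope.

(* The set Phi^+.  The quotient is taken in the fraction field of Z[q], and the
   equation says that it is the polynomial f; m = 0 gives f = 1. *)
Definition Phi_plus : set {poly int} :=
  [set f : {poly int} | (forall k, 0 <= f`_k) /\
     exists (m : nat) (a b : 'I_m -> nat),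
       [/\ forall j, (0 < a j)%N, forall j, (0 < b j)%N
         & f%:F = \prod_(j < m) ((qint (a j))%:F / (qint (b j))%:F)]].

Section CharacteristicFunction.
Variable R : realType.
Implicit Types (f : {poly int}) (z : R[i]).

(* P(X = k) for the random variable X with E[q^X] = f(q)/f(1): the coefficient
   of q^k; see cgf_expect_exp. *)
Definition cgf_pmf f (k : nat) : R := (f`_k)%:~R / (f.[1])%:~R.

(* E[g(X)]; X takes its values in {0, ..., deg f}. *)
Definition cgf_expect f (g : R -> R) : R :=
  \sum_(k < size f) g k%:R * cgf_pmf f k.

Definition cgf_mean f : R := cgf_expect f id.

Definition cgf_variance f : R :=
  cgf_expect f (fun x => (x - cgf_mean f) ^+ 2).

Definition cgf_sd f : R := Num.sqrt (cgf_variance f).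

Lemma cgf_expect_exp f (q : R) :
  \sum_(k < size f) q ^+ k * cgf_pmf f k
  = (map_poly intr f).[q] / (f.[1])%:~R.
Proof.
rewrite (horner_coef_wide _ (size_poly _ _)) mulr_suml.
by apply: eq_bigr => k _; rewrite coef_map /cgf_pmf mulrA [q ^+ k * _]mulrC.
Qed.

Definition cexp z : R[i] :=
  (expR (complex.Re z))%:C
  * (cos (complex.Im z) +i* sin (complex.Im z)).

(* 1 is the only constant polynomial in Phi_plus. *)
Definition std_charfun f : R[i] -> R[i] :=
  if f == 1 then fun=> 1
  else fun z =>
    cexp (- ('i%C * z * (cgf_mean f)%:C / (cgf_sd f)%:C))
    * (map_poly intr f).[cexp ('i%C * z / (cgf_sd f)%:C)] / (f.[1])%:~R.

Definition C_CGF : set (R[i] -> R[i]) := std_charfun @` Phi_plus.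

End CharacteristicFunction.

Arguments C_CGF R : clear implicits.

(* R[i]^o is the type R[i] with its structure of normed space over itself, so
   that derivability below is complex differentiability. *)
Definition entire (R : realType) (f : R[i] -> R[i]) : Prop :=
  forall z, derivable (f : R[i]^o -> R[i]^o) z 1.

Definition cvg_compact_uniform (R : realType)
    (u : nat -> R[i] -> R[i]) (g : R[i] -> R[i]) : Prop :=
  forall K : set R[i]^o, compact K ->
    {uniform K, (u : nat -> R[i]^o -> R[i]^o) @ \oo --> (g : R[i]^o -> R[i]^o)}.

Definition normal_family (R : realType) (F : set (R[i] -> R[i])) : Prop :=
  forall u : nat -> R[i] -> R[i], (forall n, F (u n)) ->
    exists2 s : nat -> nat, {homo s : m n / (m < n)%N} &
      exists g : R[i] -> R[i], cvg_compact_uniform (fun n => u (s n)) g.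

(* Main.v *)
(* By comparing f * prod [b_j]_q = prod [a_j]_q with [a]_q (q - 1) = q^a - 1, a
   CGF f is monic and all its complex roots lie on the unit circle, away from
   1.  As f is real, f^2 is therefore the product over the n roots of the
   quadratics q^2 - 2 c q + 1 with -1 <= c < 1.  Evaluating at 1 the first two
   derivatives gives mu = n / 2 and sigma^2 = sum 1 / (2 - 2 c) >= n / 4, and,
   with 1 + t <= exp t on each factor, for q > 0,
   (f(q) / f(1))^2 <= q^n exp (sigma^2 (q - 1)^2 / q).  At q = e^(s / sigma)
   this bounds the standardized moment generating function at real s by a
   quantity that depends on s alone, since sigma >= 1 / 2.  The coefficients
   being nonnegative, the characteristic functions are then Lipschitz on each
   disc with a constant independent of f.  Normality follows by an
   Arzela-Ascoli argument. *)

Require Import Defs.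
From mathcomp Require Import all_boot all_order all_algebra.
From mathcomp Require Import all_classical all_reals all_analysis.
From mathcomp Require Import complex ring lra.

Set Implicit Arguments.
Unset Strict Implicit.
Unset Printing Implicit Defensive.

Import Order.TTheory GRing.Theory Num.Theory.
Import numFieldNormedType.Exports.
Import Normc.

Local Open Scope classical_set_scope.
Local Open Scope complex_scope.
Local Open Scope ring_scope.

(** * Roots of cyclotomic generating functions *)

Lemma qint_monic n : (0 < n)%N -> qint n \is monic.
Proof.
case: n => // n _; rewrite monicE lead_coefE.
have -> : qint n.+1 = \poly_(i < n.+1) 1.
  by rewrite poly_def; apply: eq_bigr => i _; rewrite scale1r.
by rewrite size_poly_eq ?oner_eq0 // coef_poly leqnn.
Qed.

Lemma qint_factor n : qint n * ('X - 1) = 'X^n - 1.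
Proof. by rewrite /qint subrX1 mulrC. Qed.

(** The embedding into the fraction field is injective and each [qint (b j)] is monic, hence nonzero
    there, so the denominators can be cleared. From here on only polynomials occur. *)
Lemma Phi_plus_prod f : Phi_plus f -> exists (m : nat) (a b : 'I_m -> nat),
  [/\ forall j, (0 < a j)%N, forall j, (0 < b j)%N
    & f * \prod_(j < m) qint (b j) = \prod_(j < m) qint (a j)].
Proof.
case=> _ [m] [a] [b] [a0 b0 e]; exists m, a, b; split=> //.
apply/eqP; rewrite -tofrac_eq; apply/eqP.
rewrite tofracM e !rmorph_prod -big_split /=; apply: eq_bigr => j _.
by rewrite mulfVK // tofrac_eq0 monic_neq0 // qint_monic.
Qed.

Lemma Phi_plus_monic f : Phi_plus f -> f \is monic.
Proof.
move=> /Phi_plus_prod[m] [a] [b] [a0 b0 e].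
have mon (c : 'I_m -> nat) : (forall j, (0 < c j)%N) ->
    \prod_(j < m) qint (c j) \is monic.
  by move=> c0; apply: monic_prod => j _; exact: qint_monic.
by rewrite -(monicMr _ (mon b b0)) e mon.
Qed.

Lemma qint_root (C : numFieldType) n (z : C) : (0 < n)%N ->
  root (map_poly intr (qint n)) z -> z != 1 /\ z ^+ n = 1.
Proof.
move=> n0 /rootP hz; split; last first.
  have := congr1 (fun p => (map_poly intr p).[z]) (qint_factor n).
  rewrite rmorphM !hornerM hz mul0r rmorphB /= map_polyXn rmorph1 !hornerE.
  by move=> /esym/eqP; rewrite subr_eq0 => /eqP.
apply/eqP => z1; move: hz; rewrite z1 /qint rmorph_sum horner_sum /=.
rewrite (eq_bigr (fun=> 1)); last first.
  by move=> i _; rewrite map_polyXn hornerXn expr1n.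
by move/eqP; rewrite sumr_const card_ord pnatr_eq0 eqn0Ngt n0.
Qed.

(** A root of [f] is a root of the cleared identity's right side, hence of some [qint (a j)], whose
    roots are roots of unity other than 1. *)
Lemma Phi_plus_root (C : numFieldType) f (z : C) : Phi_plus f ->
  root (map_poly intr f) z -> z != 1 /\ `|z| = 1.
Proof.
move=> /Phi_plus_prod[m] [a] [b] [a0 b0 e] /rootP hz.
have /eqP : (map_poly intr (\prod_(j < m) qint (a j))).[z] = 0.
  by rewrite -e rmorphM hornerM hz mul0r.
rewrite rmorph_prod horner_prod prodf_seq_eq0 => /hasP[j _] /=.
rewrite -rootE => /(qint_root (a0 j))[z1 za].
split=> //; apply/eqP; rewrite -(@pexpr_eq1 _ _ (a j)) //.
by rewrite -normrX za normr1.
Qed.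

(* ['X - z%:P] times its conjugate, for [z] on the unit circle with real part
   [c]. *)
Definition circle_quad (R : nzRingType) (c : R) : {poly R} :=
  'X^2 - (c *+ 2) *: 'X + 1.

(** Working with the square avoids pairing each root with its conjugate and treating the root -1
    apart: every root, with multiplicity, contributes one quadratic, so [size cs] is the degree of
    [f]. *)
Lemma Phi_plus_sqr (R : realType) f : Phi_plus f ->
  exists cs : seq R, [/\ all (fun c => -1 <= c < 1) cs,
    (map_poly intr f) ^+ 2 = \prod_(c <- cs) circle_quad c
    & size f = (size cs).+1].
Proof.
move=> fP; have fm := Phi_plus_monic fP.
pose p : {poly R[i]} := map_poly intr f.
have pm : p \is monic by exact: monic_map.
have [rs prs] := closed_field_poly_normal p.
rewrite (monicP pm) scale1r in prs.
have zP z : z \in rs -> z != 1 /\ complex.Re z ^+ 2 + complex.Im z ^+ 2 = 1.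
  move=> zrs; have /(Phi_plus_root fP)[z1 nz] : root p z.
    by rewrite prs root_prod_XsubC.
  by split=> //; apply: (@complexI R); rewrite add_Re2_Im2 nz expr1n.
exists (map (@complex.Re R) rs); split.
- apply/allP => _ /mapP[z zrs ->]; have [z1 nz] := zP _ zrs.
  have c2 : complex.Re z ^+ 2 <= 1 by rewrite -nz lerDl sqr_ge0.
  have /andP[c1 c1'] : -1 <= complex.Re z <= 1.
    by rewrite -ler_norml -(@ler_pXn2r _ 2) ?nnegrE // real_normK ?expr1n ?num_real.
  (* On the unit circle, real part 1 forces imaginary part 0, that is z = 1, which is excluded. *)
  rewrite c1 /= lt_neqAle c1' andbT; apply: contra_neq z1 => e.
  case: z nz e {c2 c1 c1' zrs} => a b /= + a1; rewrite a1 expr1n => h.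
  have /eqP : b ^+ 2 = 0 by apply: (addrI 1); rewrite h addr0.
  by rewrite sqrf_eq0 => /eqP ->.
- apply: (map_inj_poly (@complexI R) (rmorph0 _)).
  have pE : map_poly (real_complex R) (map_poly intr f) = p.
    by rewrite -map_poly_comp; apply: eq_map_poly => k /=; rewrite rmorph_int.
  have pJ : map_poly (@conjc R) p = p.
    by rewrite -map_poly_comp; apply: eq_map_poly => k /=; rewrite rmorph_int.
  (* One of the two factors [p] is replaced by its conjugate, so that each ['X - z] meets its
     conjugate factor. *)
  rewrite rmorphXn /= pE expr2 -{2}pJ prs !rmorph_prod big_map -big_split /=.
  rewrite !big_seq; apply: eq_bigr => z /zP[_ nz].
  rewrite /circle_quad !rmorphB !rmorphD /= !map_polyX !map_polyC /=.
  rewrite rmorph1 rmorphN /= map_polyXn map_polyZ map_polyX.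
  have e1 : (complex.Re z *+ 2)%:C = z + z^*%C by rewrite addcJ rmorphMn mulr_natl.
  have e2 : z * z^*%C = 1 by rewrite -sqr_normc -add_Re2_Im2 nz.
  have -> (x : {poly R[i]}) y : ('X - x) * ('X - y) = 'X^2 - (x + y) * 'X + x * y.
    by ring.
  by rewrite -polyCM -polyCD e2 -mul_polyC -e1.
- rewrite size_map -(size_map_inj_poly (@intr_inj R[i]) (rmorph0 _)).
  by rewrite -[LHS]/(size p) prs size_prod_XsubC.
Qed.

(** * Moments *)

Section Moments.
Variable R : realType.
Implicit Types (f : {poly int}) (cs : seq R) (x v s : R).

Lemma expR_dist1 v : `|expR v - 1| <= `|v| * expR `|v|.
Proof.
have [v0|v0] := leP 0 v.
  rewrite !ger0_norm // ?subr_ge0; last by rewrite -expR0 ler_expR.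
  have := ler_wpM2l (expR_ge0 v) (expR_ge1Dx (- v)).
  by rewrite expRxMexpNx_1; lra.
have e1 : expR v <= 1 by rewrite -expR0 ler_expR ltW.
rewrite ler0_norm ?subr_le0 // ltr0_norm //.
have : - v * 1 <= - v * expR (- v).
  by rewrite ler_wpM2l ?oppr_ge0 ?ltW // -expR0 ltr_expR oppr_gt0.
have := expR_ge1Dx v; lra.
Qed.

(** For z on the unit circle with real part c, 2 - 2c is |1 - z|^2, the value of [circle_quad c] at
    1. The sum turns out to be the variance. *)
Definition circle_weight cs : R := \sum_(c <- cs) (2 - 2 * c)^-1.

Lemma circle_weight_ge cs : all (fun c => -1 <= c < 1) cs ->
  (size cs)%:R / 4 <= circle_weight cs.
Proof.
rewrite /circle_weight; elim: cs => [_|c cs IH /= /andP[/andP[c1 c2] /IH h]].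
  by rewrite mul0r big_nil.
rewrite big_cons -natr1 mulrDl mul1r addrC lerD // lef_pV2 ?posrE; lra.
Qed.

(** Each factor q satisfies q'(1) = q(1) = 2 - 2c and q''(1) = 2. Hence every factor has logarithmic
    derivative 1 at 1, and the Leibniz rule gives the n^2 - n mixed terms and twice the weight. *)
Lemma prod_circle_quad cs : all (fun c => -1 <= c < 1) cs ->
  let P := \prod_(c <- cs) circle_quad c in let n : R := (size cs)%:R in
  [/\ 0 < P.[1], P^`().[1] = n * P.[1] &
      P^`()^`().[1] = (2 * circle_weight cs + n ^+ 2 - n) * P.[1]].
Proof.
rewrite /circle_weight.
elim: cs => [_|c cs IH /= /andP[/andP[c1 c2] /IH [h1 h2 h3]]].
  by rewrite /= !big_nil !derivC !hornerE; split=> //; ring.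
have q1 : (circle_quad c).[1] = 2 - 2 * c.
  by rewrite /circle_quad !hornerE expr1n; ring.
have dq : (circle_quad c)^`() = 'X *+ 2 - (c *+ 2)%:P.
  rewrite /circle_quad -[1]/(1%:P).
  by rewrite !(derivD, derivN, derivXn, derivZ, derivX, derivC) addr0 alg_polyC.
have dq1 : (circle_quad c)^`().[1] = 2 - 2 * c.
  by rewrite dq !hornerE; ring.
have ddq1 : (circle_quad c)^`()^`().[1] = 2.
  by rewrite dq derivB derivMn derivX derivC subr0 hornerMn hornerC.
rewrite !big_cons -natr1; move: h1 h2 h3; set P := \prod_(_ <- _) _.
move: (circle_quad c) P q1 {dq} dq1 ddq1 => q P q1 dq1 ddq1 h1 h2 h3.
rewrite !derivM !derivD !derivM !hornerE h2 h3 q1 dq1 ddq1 /=.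
split.
- by apply: mulr_gt0 => //; lra.
- by ring.
- by field; lra.
Qed.

(** With y = (x - 1)^2 / x, a factor at x equals x (2 - 2c) (1 + y / (2 - 2c)), and 1 + t <= e^t
    applies. Nonnegativity is carried along so that the inequalities can be multiplied. *)
Lemma prod_circle_quad_le cs x : all (fun c => -1 <= c < 1) cs -> 0 < x ->
  let P := \prod_(c <- cs) circle_quad c in
  0 <= P.[x] <=
    x ^+ size cs * P.[1] * expR ((x - 1) ^+ 2 / x * circle_weight cs).
Proof.
move=> + x0; rewrite /circle_weight.
elim: cs => [_|c cs IH /= /andP[/andP[c1 c2] /[dup] cs1 /IH /andP[h0 h]]].
  by rewrite !big_nil mulr0 expR0 !hornerE ler01 /=.
have [p1 _ _] := prod_circle_quad cs1.
rewrite !big_cons !hornerM mulrDr expRD.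
move: h0 h p1; set w := \sum_(_ <- _) _; set y := (x - 1) ^+ 2 / x.
set P := \prod_(_ <- _) _ => h0 h p1.
have y0 : 0 <= y by rewrite divr_ge0 ?sqr_ge0 // ltW.
have q1 : (circle_quad c).[1] = 2 - 2 * c.
  by rewrite /circle_quad !hornerE expr1n; ring.
have c0 : 0 < 2 - 2 * c by lra.
have qx : (circle_quad c).[x] = x * (2 - 2 * c) * (1 + y / (2 - 2 * c)).
  rewrite /circle_quad !hornerE /y; field.
  by rewrite !lt0r_neq0.
have d0 : 0 <= 1 + y / (2 - 2 * c).
  by rewrite addr_ge0 // divr_ge0 // ltW.
have a0 : 0 <= x * (2 - 2 * c) by apply: mulr_ge0; apply: ltW.
rewrite qx q1; apply/andP; split; first by do 2![apply: mulr_ge0 => //].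
rewrite exprS [leRHS](_ : _ = (x * (2 - 2 * c) * expR (y / (2 - 2 * c))) *
  (x ^+ size cs * P.[1] * expR (y * w))); last by ring.
rewrite ler_pM //; first by rewrite mulr_ge0.
by rewrite ler_wpM2l ?expR_ge1Dx.
Qed.

Lemma horner_map1 f : (map_poly intr f).[1] = (f.[1])%:~R :> R.
Proof. by rewrite -[1 in LHS](rmorph1 (intr : int -> R)) horner_map. Qed.

Lemma map_poly_intrE f :
  map_poly intr f = \poly_(k < size f) ((f`_k)%:~R : R).
Proof. by []. Qed.

Lemma deriv_horner1 f :
  (map_poly intr f)^`().[1] = \sum_(k < size f) k%:R * (f`_k)%:~R :> R.
Proof.
rewrite map_poly_intrE poly_def raddf_sum horner_sum; apply: eq_bigr => k _ /=.
by rewrite derivZ derivXn hornerZ hornerMn hornerXn expr1n mulrC.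
Qed.

Lemma deriv2_horner1 f : (map_poly intr f)^`()^`().[1]
  = \sum_(k < size f) k%:R * (k%:R - 1) * (f`_k)%:~R :> R.
Proof.
rewrite map_poly_intrE poly_def !raddf_sum horner_sum.
apply: eq_bigr => -[k kn] _ /=.
rewrite !derivZ derivXn derivMn derivXn hornerZ !hornerMn hornerXn expr1n.
(* At k = 0 the truncated predecessor differs from k - 1, but both sides vanish through the factor
   k. *)
case: k kn => [|k] kn; first by rewrite /= !mul0r mulr0n mulr0.
by rewrite /= -mulrnA -natr1 addrK mulrC natrM natr1 [k%:R * _]mulrC.
Qed.

Lemma cgf_expectE f (g : R -> R) :
  cgf_expect f g = (\sum_(k < size f) g k%:R * (f`_k)%:~R) / (f.[1])%:~R.
Proof. by rewrite mulr_suml; apply: eq_bigr => k _; rewrite mulrA. Qed.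

Lemma cgf_mean_deriv f :
  cgf_mean R f = (map_poly intr f)^`().[1] / (f.[1])%:~R.
Proof. by rewrite /cgf_mean cgf_expectE deriv_horner1. Qed.

Lemma sum_coef1 f : \sum_(k < size f) (f`_k)%:~R = (f.[1])%:~R :> R.
Proof.
rewrite -horner_map1 (horner_coef_wide _ (size_poly _ _)).
by apply: eq_bigr => k _; rewrite coef_map expr1n mulr1.
Qed.

Lemma cgf_variance_deriv f : (f.[1])%:~R != 0 :> R ->
  cgf_variance R f = (map_poly intr f)^`()^`().[1] / (f.[1])%:~R
    + cgf_mean R f - cgf_mean R f ^+ 2.
Proof.
move=> f1; rewrite /cgf_variance cgf_expectE; set m := cgf_mean R f.
have mE : \sum_(k < size f) k%:R * (f`_k)%:~R = m * (f.[1])%:~R.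
  by rewrite /m cgf_mean_deriv divfK // deriv_horner1.
clearbody m; rewrite deriv2_horner1; apply: (mulIf f1).
rewrite mulrBl mulrDl !divfK //.
(* The square (k - m)^2 is expanded as k (k - 1) + (1 - 2m) k + m^2 to isolate the second factorial
   moment. *)
transitivity (\sum_(k < size f) k%:R * (k%:R - 1) * (f`_k)%:~R +
  (1 - 2 * m) * (\sum_(k < size f) k%:R * (f`_k)%:~R) +
  m ^+ 2 * (\sum_(k < size f) (f`_k)%:~R)).
  rewrite !mulr_sumr -!big_split /=; apply: eq_bigr => k _ /=; ring.
rewrite mE sum_coef1; ring.
Qed.

(** With F the polynomial [f] over the reals and w the weight, the derivatives of F^2 at 1 give 2 F
    F' = n F^2 and 2 F'^2 + 2 F F'' = (2w + n^2 - n) F^2. Solving for F' and F'', all terms in n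
    cancel from the variance and w remains. *)
Lemma Phi_plus_moments f : Phi_plus f -> f != 1 ->
  exists cs, [/\ all (fun c => -1 <= c < 1) cs, (0 < size cs)%N,
    (map_poly intr f) ^+ 2 = \prod_(c <- cs) circle_quad c,
    cgf_mean R f = (size cs)%:R / 2 & cgf_variance R f = circle_weight cs].
Proof.
move=> fP f1; have [cs [cs1 fcs sz]] := Phi_plus_sqr R fP; exists cs.
have [] := prod_circle_quad cs1; rewrite /= -fcs.
set F := map_poly intr f => p0 p1 p2.
have F0 : F.[1] != 0.
  by move: p0; rewrite horner_exp; apply: contraTneq => ->; rewrite expr0n ltxx.
have F0' : (f.[1])%:~R != 0 :> R by rewrite -horner_map1.
move: p1 p2; rewrite expr2 !derivM !derivD !derivM !hornerE /= => p1 p2.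
have e1 : F^`().[1] = (size cs)%:R / 2 * F.[1].
  apply: (mulIf F0); lra.
have mE : cgf_mean R f = (size cs)%:R / 2.
  by rewrite cgf_mean_deriv -horner_map1 -/F e1 mulfK.
split=> //.
  (* Without roots [f] would be a monic constant, that is 1. *)
  rewrite lt0n; apply: contra_neqN f1 => /eqP s0.
  move: sz (Phi_plus_monic fP); rewrite s0 => /eqP/size_poly1P[c _ ->].
  by rewrite monicE lead_coefC => /eqP ->.
rewrite cgf_variance_deriv // mE -horner_map1 -/F.
suff -> : F^`()^`().[1] = ((2 * circle_weight cs + (size cs)%:R ^+ 2
    - (size cs)%:R) / 2 - ((size cs)%:R / 2) ^+ 2) * F.[1].
  by rewrite mulfK //; field.
apply: (mulIf F0); move: p2; rewrite !e1 => p2; lra.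
Qed.

(** The quadratics give f(1)^2 > 0; the sign comes from the nonnegative coefficients. *)
Lemma Phi_plus_horner1_gt0 f : Phi_plus f -> 0 < (f.[1])%:~R :> R.
Proof.
move=> fP; have [cs [cs1 fcs _]] := Phi_plus_sqr R fP.
have [] := prod_circle_quad cs1; rewrite /= -fcs horner_exp horner_map1 => + _ _.
rewrite exprn_even_gt0 //= lt_neqAle eq_sym => -> /=.
rewrite -sum_coef1 sumr_ge0 // => k _; rewrite ler0z.
by case: fP => + _; apply.
Qed.

Lemma cgf_pmf_ge0 f k : Phi_plus f -> 0 <= cgf_pmf R f k.
Proof.
move=> fP; apply: divr_ge0; last exact/ltW/Phi_plus_horner1_gt0.
by rewrite ler0z; case: fP => + _; apply.
Qed.

Lemma cgf_sd_ge f : Phi_plus f -> f != 1 -> 1 / 2 <= cgf_sd R f.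
Proof.
move=> fP f1; have [cs [cs1 s0 _ _ vE]] := Phi_plus_moments fP f1.
have := circle_weight_ge cs1; rewrite /cgf_sd vE => h.
have n1 : 1 <= (size cs)%:R :> R by rewrite ler1n.
by rewrite -(@ler_pXn2r _ 2) ?nnegrE ?sqrtr_ge0 // ?sqr_sqrtr; lra.
Qed.

(* With [v = s / sigma] and [`|v| <= 2 * `|s|], the exponent
   [sigma^2 (e^v - 1)^2 e^(-v)] is at most [sigma^2 v^2 e^(3 `|v|)]. *)
Definition mgf_bound s : R := expR (s ^+ 2 * expR (6 * `|s|)).

Lemma cgf_mgf_le f s : Phi_plus f -> f != 1 ->
  cgf_expect f (fun x => expR (s * ((x - cgf_mean R f) / cgf_sd R f)))
    <= mgf_bound s.
Proof.
move=> fP f1; have sd := cgf_sd_ge fP f1; have F0 := Phi_plus_horner1_gt0 fP.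
have sd0 : 0 < cgf_sd R f by lra.
have [cs [cs1 s0 fcs mE vE]] := Phi_plus_moments fP f1.
have w0 : 0 < circle_weight cs by rewrite -vE -sqrtr_gt0.
set M := cgf_expect _ _; pose v := s / cgf_sd R f; pose x := expR v.
have x0 : 0 < x := expR_gt0 _.
pose F : {poly R} := map_poly intr f.
have ME : M = F.[x] / F.[1] * expR (- (v * cgf_mean R f)).
  rewrite horner_map1 -cgf_expect_exp mulr_suml; apply: eq_bigr => k _.
  rewrite mulrAC; congr (_ * _); rewrite -expRM_natl -expRD; congr expR.
  by rewrite /v; field; exact: lt0r_neq0.
(* As the mean is n / 2, the squared centring factor is exactly x^(-n) and cancels the power of x in
   the bound on the quadratics. *)
have M2 : M ^+ 2 <= expR ((x - 1) ^+ 2 / x * circle_weight cs).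
  have /= /andP[_] := prod_circle_quad_le cs1 x0; rewrite -fcs !horner_exp => h.
  have -> : M ^+ 2 = F.[x] ^+ 2 / (x ^+ size cs * F.[1] ^+ 2).
    have e2 : expR (- (v * ((size cs)%:R / 2))) ^+ 2 = (x ^+ size cs)^-1.
      rewrite -2!expRM_natl -expRN; congr expR; by field.
    by rewrite ME mE exprMn e2 expr_div_n -mulrA; congr (_ * _);
      rewrite mulrC -invfM.
  by rewrite ler_pdivrMr ?mulr_gt0 ?exprn_gt0 // 1?mulrC // /F horner_map1.
have xv : (x - 1) ^+ 2 / x <= v ^+ 2 * expR (6 * `|s|).
  have v2 : `|v| <= 2 * `|s|.
    rewrite /v normrM normfV (gtr0_norm sd0) ler_pdivrMr //.
    have : `|s| * 1 <= `|s| * (2 * cgf_sd R f) by rewrite ler_wpM2l //; lra.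
    lra.
  have xV : x^-1 <= expR `|v| by rewrite /x -expRN ler_expR -normrN ler_norm.
  have -> : (x - 1) ^+ 2 / x = `|x - 1| ^+ 2 * x^-1.
    by rewrite real_normK ?num_real.
  apply: (@le_trans _ _ ((`|v| * expR `|v|) ^+ 2 * expR `|v|)).
    apply: ler_pM => //; rewrite ?sqr_ge0 ?invr_ge0 ?(ltW x0) //.
    by rewrite ler_pXn2r ?nnegrE ?mulr_ge0 ?expR_ge0 // expR_dist1.
  rewrite exprMn real_normK ?num_real // -mulrA ler_wpM2l ?sqr_ge0 //.
  by rewrite -expRM_natl -expRD ler_expR; lra.
have {}M2 : M ^+ 2 <= mgf_bound s.
  apply: le_trans M2 _; rewrite ler_expR.
  have <- : v ^+ 2 * circle_weight cs = s ^+ 2.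
    rewrite /v /cgf_sd vE expr_div_n sqr_sqrtr ?divfK ?ltW //.
    exact: lt0r_neq0.
  by rewrite [leRHS]mulrAC ler_wpM2r // ltW.
have E1 : 1 <= mgf_bound s.
  by rewrite -expR0 ler_expR mulr_ge0 ?sqr_ge0 ?expR_ge0.
(* Since the bound E is at least 1, M > E would give M^2 > M > E; so no square root is needed. *)
rewrite leNgt; apply/negP => EM; move: M2; rewrite leNgt => /negP; apply.
have M1 : 1 < M by exact: le_lt_trans E1 EM.
by rewrite expr2 (lt_trans EM) // ltr_pMr // (lt_trans ltr01).
Qed.

End Moments.

(** * Complex exponential sums *)

Section ComplexExponential.
Variable R : realType.
Implicit Types (x y : R) (z w : R[i]).

Lemma sin_dist0 y : `|sin y| <= `|y|.
Proof.
wlog y0 : y / 0 <= y.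
  move=> h; have [/h//|/ltW y0] := leP 0 y.
  by rewrite -normrN -sinN -(normrN y) h ?oppr_ge0.
have [c _] : exists2 c, c \in `[0, y] & sin y - sin 0 = cos c * (y - 0).
  apply: MVT_segment => //.
  exact/continuous_subspaceT/continuous_sin.
rewrite sin0 !subr0 => ->; rewrite normrM ler_piMl // ler_norml.
by rewrite cos_geN1 cos_le1.
Qed.

(** Mean value theorem, with the sine at the intermediate point bounded by 1 or by [|y|]. The linear
    bound serves the Lipschitz estimate, the quadratic one differentiability. *)
Lemma cos_dist1 y : `|cos y - 1| <= `|y| /\ `|cos y - 1| <= `|y| ^+ 2.
Proof.
wlog y0 : y / 0 <= y.
  move=> h; have [/h//|/ltW y0] := leP 0 y.
  by rewrite -cosN -(normrN y); apply: h; rewrite oppr_ge0.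
have [c cy] : exists2 c, c \in `[0, y] & cos y - cos 0 = - sin c * (y - 0).
  apply: MVT_segment => //.
  exact/continuous_subspaceT/continuous_cos.
move: cy; rewrite in_itv /= => /andP[c0 cy].
rewrite cos0 subr0 => ->; rewrite normrM normrN expr2; split.
  by rewrite ler_piMl // ler_norml sin_geN1 sin_le1.
by rewrite ler_wpM2r // (le_trans (sin_dist0 c)) // !ger0_norm.
Qed.

Lemma sin_dist_id y : `|sin y - y| <= `|y| ^+ 2.
Proof.
wlog y0 : y / 0 <= y.
  move=> h; have [/h//|/ltW y0] := leP 0 y.
  by rewrite -normrN opprD -sinN -(normrN y) h ?oppr_ge0.
have [c cy] : exists2 c, c \in `[0, y] & sin y - sin 0 = cos c * (y - 0).
  apply: MVT_segment => //.
  exact/continuous_subspaceT/continuous_sin.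
move: cy; rewrite in_itv /= => /andP[c0 cy].
rewrite sin0 !subr0 => ->; rewrite -[X in _ - X]mul1r -mulrBl normrM expr2.
by rewrite ler_wpM2r // (le_trans (cos_dist1 c).1) // !ger0_norm.
Qed.

Lemma expR_dist1D x : `|expR x - 1 - x| <= `|x| ^+ 2 * expR `|x|.
Proof.
have h : expR x - 1 - x <= x * (expR x - 1).
  have := ler_wpM2l (expR_ge0 x) (expR_ge1Dx (- x)).
  by rewrite expRxMexpNx_1; lra.
rewrite ger0_norm; last by have := expR_ge1Dx x; lra.
apply: le_trans h _; apply: le_trans (ler_norm _) _; rewrite normrM expr2 -mulrA.
by rewrite ler_wpM2l // expR_dist1.
Qed.

Lemma normc_Re z : `|complex.Re z| <= normc z.
Proof. by rewrite -lecR; exact: normc_ge_Re. Qed.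

Lemma normc_Im z : `|complex.Im z| <= normc z.
Proof.
case: z => a b /=; rewrite -[leLHS]sqrtr_sqr ler_wsqrtr //.
by rewrite lerDr sqr_ge0.
Qed.

Lemma normc_le_ReIm z : normc z <= `|complex.Re z| + `|complex.Im z|.
Proof.
case: z => a b /=.
have h : 0 <= `|a| + `|b| by rewrite addr_ge0.
rewrite -[leRHS](ger0_norm h) -sqrtr_sqr ler_wsqrtr // sqrrD !real_normK ?num_real //.
by rewrite -addrA lerD2l lerDr mulrn_wge0 // mulr_ge0.
Qed.

Lemma normc_ge0 z : 0 <= normc z.
Proof. exact: le_trans (normr_ge0 _) (normc_Re z). Qed.

Lemma normc_real x : normc x%:C = `|x|.
Proof. by rewrite /= expr0n addr0 sqrtr_sqr. Qed.

Lemma cexpD z w : cexp (z + w) = cexp z * cexp w.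
Proof.
case: z => a b; case: w => c d; rewrite /cexp /= expRD cosD sinD.
apply/eqP; rewrite eq_complex /=; apply/andP; split; apply/eqP; ring.
Qed.

Lemma cexp0 : cexp 0 = 1 :> R[i].
Proof. by rewrite /cexp /= expR0 cos0 sin0 mul1r. Qed.

Lemma cexpMn n z : cexp (z *+ n) = cexp z ^+ n.
Proof.
by elim: n => [|n IH]; rewrite ?mulr0n ?expr0 ?cexp0 // mulrS cexpD IH exprS.
Qed.

Lemma normc_cexp z : normc (cexp z) = expR (complex.Re z).
Proof.
rewrite /cexp normcM normc_real ger0_norm ?expR_ge0 //=.
by rewrite cos2Dsin2 sqrtr1 mulr1.
Qed.

Lemma expR_Re_le z : expR (complex.Re z) <= expR (normc z).
Proof. by rewrite ler_expR (le_trans (ler_norm _)) // normc_Re. Qed.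

(** For z = a + ib the difference splits into e^a (cos b - 1), e^a - 1 and e^a sin b, each at most
    |z| e^|z|; hence the 3. *)
Lemma normc_cexp_sub1 z :
  normc (cexp z - 1) <= 3 * normc z * expR (normc z).
Proof.
have eN := expR_Re_le z.
apply: le_trans (normc_le_ReIm _) _.
have -> : complex.Re (cexp z - 1) = expR (complex.Re z) *
    (cos (complex.Im z) - 1) + (expR (complex.Re z) - 1).
  by rewrite /cexp /=; ring.
have -> : complex.Im (cexp z - 1) = expR (complex.Re z) * sin (complex.Im z).
  by rewrite /cexp /=; ring.
have N0 := normc_ge0 z; have e0 := expR_ge0 (complex.Re z).
have h1 : expR (complex.Re z) * `|cos (complex.Im z) - 1|
    <= expR (normc z) * normc z.
  by apply: ler_pM => //; apply: le_trans (cos_dist1 _).1 (normc_Im z).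
have h2 : expR (complex.Re z) * `|sin (complex.Im z)|
    <= expR (normc z) * normc z.
  by apply: ler_pM => //; apply: le_trans (sin_dist0 _) (normc_Im z).
have h3 : `|expR (complex.Re z) - 1| <= normc z * expR (normc z).
  apply: le_trans (expR_dist1 _) _; apply: ler_pM => //; first exact: normc_Re.
  by rewrite ler_expR normc_Re.
have := ler_normD (expR (complex.Re z) * (cos (complex.Im z) - 1))
  (expR (complex.Re z) - 1).
rewrite !normrM (ger0_norm e0); lra.
Qed.

(** The same splitting now leaves four terms, each at most |z|^2 e^|z|. *)
Lemma normc_cexp_sub1D z :
  normc (cexp z - 1 - z) <= 4 * normc z ^+ 2 * expR (normc z).
Proof.
have eN := expR_Re_le z.
apply: le_trans (normc_le_ReIm _) _.
have -> : complex.Re (cexp z - 1 - z) = expR (complex.Re z) *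
    (cos (complex.Im z) - 1) + (expR (complex.Re z) - 1 - complex.Re z).
  by case: z {eN} => a b; rewrite /cexp /=; ring.
have -> : complex.Im (cexp z - 1 - z) = expR (complex.Re z) *
    (sin (complex.Im z) - complex.Im z)
    + (expR (complex.Re z) - 1) * complex.Im z.
  by case: z {eN} => a b; rewrite /cexp /=; ring.
have N0 := normc_ge0 z; have e0 := expR_ge0 (complex.Re z).
have I2 : `|complex.Im z| ^+ 2 <= normc z ^+ 2.
  by rewrite ler_pXn2r ?nnegrE // normc_Im.
have R2 : `|complex.Re z| ^+ 2 <= normc z ^+ 2.
  by rewrite ler_pXn2r ?nnegrE // normc_Re.
have eR : expR `|complex.Re z| <= expR (normc z) by rewrite ler_expR normc_Re.
have h1 : expR (complex.Re z) * `|cos (complex.Im z) - 1|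
    <= expR (normc z) * normc z ^+ 2.
  by apply: ler_pM => //; apply: le_trans (cos_dist1 _).2 I2.
have h2 : expR (complex.Re z) * `|sin (complex.Im z) - complex.Im z|
    <= expR (normc z) * normc z ^+ 2.
  by apply: ler_pM => //; apply: le_trans (sin_dist_id _) I2.
have h3 : `|expR (complex.Re z) - 1 - complex.Re z|
    <= normc z ^+ 2 * expR (normc z).
  by apply: le_trans (expR_dist1D _) _; apply: ler_pM.
have h4 : `|expR (complex.Re z) - 1| * `|complex.Im z|
    <= normc z * expR (normc z) * normc z.
  apply: ler_pM => //; last exact: normc_Im.
  apply: le_trans (expR_dist1 _) _; apply: ler_pM => //.
  exact: normc_Re.
have := ler_normD (expR (complex.Re z) * (cos (complex.Im z) - 1))
  (expR (complex.Re z) - 1 - complex.Re z).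
have := ler_normD (expR (complex.Re z) * (sin (complex.Im z) - complex.Im z))
  ((expR (complex.Re z) - 1) * complex.Im z).
rewrite !normrM (ger0_norm e0); move: h4; rewrite mulrAC -expr2; lra.
Qed.

Lemma Re_iM z x : complex.Re ('i%C * z * x%:C) = - (complex.Im z * x).
Proof. by case: z => a b /=; ring. Qed.

Lemma normc_iM z x : normc ('i%C * z * x%:C) = normc z * `|x|.
Proof. by rewrite !normcM normc_real /= expr0n add0r expr1n sqrtr1 mul1r. Qed.

Lemma normcD z w : normc (z + w) <= normc z + normc w.
Proof. exact: le_normcD. Qed.

Lemma normcB z w : normc (z - w) <= normc z + normc w.
Proof. by rewrite -(normcN w); exact: normcD. Qed.

Lemma normc_sum n (F : 'I_n -> R[i]) :
  normc (\sum_(k < n) F k) <= \sum_(k < n) normc (F k).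
Proof.
elim/big_ind2 : _ => [|x z y w zx wy|//]; first by rewrite normc0.
exact: le_trans (normcD z w) (lerD zx wy).
Qed.

(* The factor [`|t k|] coming from differentiation is absorbed by
   [expR `|t k|], which is at most [expR (t k) + expR (- t k)]. *)
Lemma cexp_sum_lipschitz n (p t : 'I_n -> R) (E : R -> R) :
  (forall k, 0 <= p k) ->
  (forall s, \sum_(k < n) p k * expR (s * t k) <= E s) ->
  forall r z w, normc z <= r -> normc w <= r ->
  normc (\sum_(k < n) (p k)%:C * cexp ('i%C * z * (t k)%:C)
       - \sum_(k < n) (p k)%:C * cexp ('i%C * w * (t k)%:C))
    <= 3 * (E (1 + 3 * r) + E (- (1 + 3 * r))) * normc (z - w).
Proof.
(* In the coefficient of [|t k|], r comes from the modulus of the exponential at w, 2r from |z - w|,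
   and 1 from absorbing the linear factor. *)
move=> p0 hE r z w zr wr; set s := 1 + 3 * r.
have zw2 : normc (z - w) <= 2 * r.
  by have := normcB z w; lra.
rewrite -sumrB; apply: le_trans (normc_sum _) _.
have hk k : normc ((p k)%:C * cexp ('i%C * z * (t k)%:C)
     - (p k)%:C * cexp ('i%C * w * (t k)%:C)) <=
     3 * (p k * expR (s * t k) + p k * expR (- s * t k)) * normc (z - w).
  rewrite -mulrBr normcM normc_real (ger0_norm (p0 k)) -mulrDr [3 * _]mulrCA.
  rewrite -(mulrA (p k)); apply: ler_wpM2l => //.
  have -> : cexp ('i%C * z * (t k)%:C) - cexp ('i%C * w * (t k)%:C) =
      cexp ('i%C * w * (t k)%:C) * (cexp ('i%C * (z - w) * (t k)%:C) - 1).
    by rewrite mulrBr -cexpD mulr1; congr (cexp _ - _); ring.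
  rewrite normcM normc_cexp Re_iM.
  have := normc_cexp_sub1 ('i%C * (z - w) * (t k)%:C); rewrite normc_iM.
  set N := normc (z - w) in zw2 *; set T := `|t k| => h.
  have N0 : 0 <= N := normc_ge0 _.
  have r0 : 0 <= r := le_trans (normc_ge0 _) zr.
  have T0 : 0 <= T := normr_ge0 _.
  have eT : expR (s * T) <= expR (s * t k) + expR (- s * t k).
    rewrite /T; case: ger0P => _; first by rewrite lerDl expR_ge0.
    by rewrite mulrN -mulNr lerDr expR_ge0.
  have h1 : expR (- (complex.Im w * t k)) <= expR (r * T).
    rewrite ler_expR; apply: le_trans (ler_norm _) _; rewrite normrN normrM.
    by rewrite ler_wpM2r // (le_trans (normc_Im w)).
  have h2 : expR (N * T) <= expR (2 * r * T) by rewrite ler_expR ler_wpM2r.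
  have h3 : T <= expR T by have := expR_ge1Dx T; lra.
  have h4 : expR (r * T) * (T * expR (N * T)) <= expR (s * T).
    have -> : s * T = r * T + (T + 2 * r * T) by rewrite /s; ring.
    by rewrite !expRD ler_wpM2l ?expR_ge0 // ler_pM ?expR_ge0.
  have h5 : expR (- (complex.Im w * t k)) *
      normc (cexp ('i%C * (z - w) * (t k)%:C) - 1)
      <= expR (r * T) * (3 * (N * T) * expR (N * T)).
    by rewrite ler_pM ?expR_ge0 ?normc_ge0.
  apply: le_trans h5 _.
  rewrite (_ : expR (r * T) * _ =
    3 * N * (expR (r * T) * (T * expR (N * T)))); last by ring.
  rewrite -[leRHS]mulrAC ler_wpM2l ?mulr_ge0 //; exact: le_trans eT.
apply: (@le_trans _ _ (\sum_(k < n)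
    3 * (p k * expR (s * t k) + p k * expR (- s * t k)) * normc (z - w))).
  by apply: ler_sum => k _; exact: hk.
rewrite -mulr_suml -mulr_sumr big_split /= ler_wpM2r ?normc_ge0 //.
by rewrite ler_wpM2l // lerD // hE.
Qed.

(** Absorbing the centring factor into the exponents gives a finite sum of exponentials with real
    frequencies and weights [cgf_pmf], the shape treated by [cexp_sum_lipschitz]. *)
Lemma std_charfunE f : f != 1 -> std_charfun f = fun z : R[i] =>
  \sum_(k < size f) (cgf_pmf R f k)%:C
    * cexp ('i%C * z * ((k%:R - cgf_mean R f) / cgf_sd R f)%:C).
Proof.
move=> f1; rewrite /std_charfun (negbTE f1); apply/funext => z.
rewrite (horner_coef_wide _ (size_poly _ _)) mulr_sumr mulr_suml.
apply: eq_bigr => k _; rewrite coef_map /= /cgf_pmf -cexpMn.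
rewrite mulrCA -cexpD fmorph_div !rmorph_int mulrAC; congr (_ * cexp _).
by rewrite fmorph_div rmorphB rmorph_nat -mulr_natr /=; ring.
Qed.

End ComplexExponential.

(** * Locally uniformly convergent subsequences *)

Section Subsequences.
Variable R : realType.
Implicit Types (z w d : R[i]).

(* Tychonoff's theorem yields a cluster point [g] for pointwise convergence on
   all of [T]; no diagonal argument is needed. *)
Lemma pointwise_cluster (T : eqType) (u : nat -> T -> R) (B : T -> R) :
  (forall n t, `|u n t| <= B t) ->
  exists g : T -> R, forall (s : seq T) (e : R) (N : nat), 0 < e ->
    exists2 n, (N <= n)%N & forall t, t \in s -> `|u n t - g t| < e.
Proof.
move=> uB.
have [|g [_ gcl]] := @tychonoff T (fun=> R) (fun t => [set` `[- B t, B t]])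
  (fun t => @segment_compact R _ _) (u @ \oo) _.
  by exists 0%N => // n _ t /=; rewrite in_itv /= -ler_norml.
exists g => s e N e0.
pose g' : {ptws T -> R} := g; have gF : Filter (nbhs g') := nbhs_filter g'.
(* Closeness to [g] on a finite list is a neighbourhood in the pointwise topology, so it meets every
   tail of [u]. *)
have gs : nbhs g'
    [set h : T -> R | forall t, t \in s -> `|h t - g t| < e].
  elim: s => [|t s IH]; first by apply: filterS filterT => h _ t; rewrite in_nil.
  have gt : nbhs g'
      [set h : T -> R | `|h t - g t| < e].
    apply: (@proj_continuous T (fun=> R) t g' [set y | `|y - g t| < e]).
    by apply/nbhs_ballP; exists e => // y /=; rewrite /ball /= distrC.
  apply: filterS (filterI gt IH) => h [ht hs] t'; rewrite inE => /orP[/eqP->//|].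
  exact: hs.
have uN : (u @ \oo) [set h | exists2 n, (N <= n)%N & u n = h].
  by exists N => // n /= Nn; exists n.
by have [_ [[n Nn <-] h]] := gcl _ _ uN gs; exists n.
Qed.

(** Real and imaginary parts form one real family indexed by [R[i] * bool], so that a single index
    [n] serves both. *)
Lemma normc_pointwise_cluster (u : nat -> R[i] -> R[i]) (B : R[i] -> R) :
  (forall n z, normc (u n z) <= B z) ->
  exists g : R[i] -> R[i], forall (s : seq R[i]) (e : R) (N : nat), 0 < e ->
    exists2 n, (N <= n)%N & forall z, z \in s -> normc (u n z - g z) < e.
Proof.
move=> uB.
pose v n (t : R[i] * bool) :=
  if t.2 then complex.Re (u n t.1) else complex.Im (u n t.1).
have [n [z []]/=|g gP] := @pointwise_cluster _ v (fun t => B t.1).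
- exact: le_trans (normc_Re _) (uB _ _).
- exact: le_trans (normc_Im _) (uB _ _).
exists (fun z => g (z, true) +i* g (z, false)) => s e N e0.
have e20 : 0 < e / 2 by rewrite divr_gt0.
have [n Nn h] := gP [seq (z, b) | z <- s, b <- [:: true; false]] _ N e20.
exists n => // z zs.
have hb b : `|v n (z, b) - g (z, b)| < e / 2.
  by apply: h; apply: (allpairs_f pair) => //; case: b; rewrite !inE.
apply: le_lt_trans (normc_le_ReIm _) _.
have -> : complex.Re (u n z - (g (z, true) +i* g (z, false))) =
    v n (z, true) - g (z, true) by rewrite /v /=; case: (u n z).
have -> : complex.Im (u n z - (g (z, true) +i* g (z, false))) =
    v n (z, false) - g (z, false) by rewrite /v /=; case: (u n z).
have := hb true; have := hb false; lra.
Qed.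

(** The net is the grid of mesh 1 / M on the square of half-side K; each coordinate is rounded down.
    Grid points may lie outside the disc. *)
Lemma finite_net (K M : nat) : (0 < M)%N -> exists s : seq R[i],
  forall z, normc z <= K%:R -> exists2 d, d \in s & normc (z - d) <= 2 / M%:R.
Proof.
move=> M0; pose c (i : nat) : R := i%:R / M%:R - K%:R.
have M0' : 0 < M%:R :> R by rewrite ltr0n.
have cP x : `|x| <= K%:R ->
    exists2 i, (i <= 2 * K * M)%N & `|x - c i| <= M%:R^-1.
  rewrite ler_norml => /andP[x1 x2].
  have y0 : 0 <= (x + K%:R) * M%:R by rewrite mulr_ge0 //; lra.
  have /andP[t1 t2] := truncn_itv y0; exists (Num.truncn ((x + K%:R) * M%:R)).
    rewrite -(ler_nat R) (le_trans t1) // !natrM ler_wpM2r //; lra.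
  set i := Num.truncn _ in t1 t2 *.
  have -> : x - c i = ((x + K%:R) * M%:R - i%:R) / M%:R.
    by rewrite /c; field; exact: lt0r_neq0.
  rewrite normrM normfV (gtr0_norm M0') ler_piMl ?invr_ge0 // ger0_norm.
    by rewrite -natr1 in t2; lra.
  by rewrite subr_ge0.
exists [seq c i +i* c j | i <- iota 0 (2 * K * M).+1, j <- iota 0 (2 * K * M).+1].
move=> z zK.
have [i iK hi] := cP _ (le_trans (normc_Re z) zK).
have [j jK hj] := cP _ (le_trans (normc_Im z) zK).
exists (c i +i* c j).
  by apply: (allpairs_f (fun i j => c i +i* c j)); rewrite mem_iota.
apply: le_trans (normc_le_ReIm _) _.
case: z {zK} hi hj => a b /= hi hj; lra.
Qed.

(** Closeness to [g] on a finite net extends to the whole disc by the common Lipschitz constant. *)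
Lemma lipschitz_cluster (u : nat -> R[i] -> R[i]) (B : R[i] -> R) (L : R -> R) :
  (forall n z, normc (u n z) <= B z) ->
  (forall n r z w, normc z <= r -> normc w <= r ->
    normc (u n z - u n w) <= L r * normc (z - w)) ->
  exists g : R[i] -> R[i], forall (r e : R) (N : nat), 0 < e ->
    exists2 n, (N <= n)%N & forall z, normc z <= r -> normc (u n z - g z) <= e.
Proof.
move=> uB uL; have [g gP] := normc_pointwise_cluster uB; exists g => r e N e0.
pose K := (Num.truncn `|r|).+1; have rK : r <= K%:R.
  by rewrite (le_trans (ler_norm _)) // ltW // truncnS_gt.
(* The radius is enlarged by 2 to contain the net points used. The mesh makes each Lipschitz step
   cost at most e / 4; two such steps and three errors of e / 6 add up to e. *)
pose l := `|L (K%:R + 2)| + 1; have l0 : 0 < l by rewrite ltr_pwDr.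
pose M := (Num.truncn (8 * l / e)).+1.
have M1 : 1 <= M%:R :> R by rewrite ler1n.
have lM : l * (2 / M%:R) <= e / 4.
  have := truncnS_gt (8 * l / e); rewrite -/M ltr_pdivrMr // => h.
  by rewrite mulrA ler_pdivrMr; lra.
have M2 : 2 / M%:R <= 2 :> R by rewrite ler_pdivrMr; lra.
have [s sP] := finite_net K (ltn0Sn _ : (0 < M)%N).
have e6 : 0 < e / 6 by rewrite divr_gt0.
have [n Nn hn] := gP s _ N e6; exists n => // z zr.
have zK := le_trans zr rK.
have [d ds zd] := sP z zK.
have dK : normc d <= K%:R + 2.
  have -> : d = z - (z - d) by rewrite opprB addrC subrK.
  by apply: le_trans (normcB _ _) _; lra.
have zK2 : normc z <= K%:R + 2 by lra.
have uld k : normc (u k z - u k d) <= e / 4.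
  apply: le_trans (uL k _ _ _ zK2 dK) _; apply: le_trans lM.
  apply: (@le_trans _ _ (l * normc (z - d))); last by rewrite ler_pM2l.
  by rewrite ler_wpM2r ?normc_ge0 // (le_trans (ler_norm _)) // lerDl.
(* [g] inherits the Lipschitz estimate up to [e / 3] from some [u m]. *)
have [m _ hm] := gP [:: z; d] _ 0%N e6.
have hz : normc (u m z - g z) < e / 6 by apply: hm; rewrite !inE eqxx.
have hd : normc (u m d - g d) < e / 6 by apply: hm; rewrite !inE eqxx orbT.
have -> : u n z - g z = (u n z - u n d) + (u n d - g d)
    - ((u m d - g d) + (u m z - u m d) - (u m z - g z)) by ring.
have := uld n; have := uld m; have := hn d ds.
have := normcB ((u n z - u n d) + (u n d - g d))
  ((u m d - g d) + (u m z - u m d) - (u m z - g z)).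
have := normcD (u n z - u n d) (u n d - g d).
have := normcB ((u m d - g d) + (u m z - u m d)) (u m z - g z).
have := normcD (u m d - g d) (u m z - u m d).
lra.
Qed.

(** The open discs of natural radius about 0 cover the plane; the largest radius in a finite
    subcover works. *)
Lemma compact_normc_bounded (K : set R[i]^o) : compact K ->
  exists n : nat, forall z, K z -> normc z <= n%:R.
Proof.
rewrite compact_cover => Kco.
have [||D _ DK] := Kco nat setT (fun n => [set p : R[i]^o | `|p| < n%:R]).
- move=> n _; rewrite openE => p; rewrite /= -subr_gt0 => ltpn.
  apply/nbhs_ballP; exists (n%:R - `|p|) => // q.
  rewrite -ball_normE /= ltrBrDr distrC; apply: le_lt_trans.
  by rewrite -{1}(subrK p q) ler_normD.
- move=> p _; exists (Num.truncn (normc p)).+1 => //=.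
  by rewrite -[X in _ < X](rmorph_nat (real_complex R)) ltcR truncnS_gt.
exists (\max_(i <- finmap.enum_fset D) i)%N => z /DK[n nD] /=.
rewrite -[X in _ < X](rmorph_nat (real_complex R)) ltcR => /ltW zn.
by apply: le_trans zn _; rewrite ler_nat; exact: (@leq_bigmax_seq _ _ xpredT id).
Qed.

Lemma lipschitz_subsequence (u : nat -> R[i] -> R[i]) (B : R[i] -> R)
    (L : R -> R) :
  (forall n z, normc (u n z) <= B z) ->
  (forall n r z w, normc z <= r -> normc w <= r ->
    normc (u n z - u n w) <= L r * normc (z - w)) ->
  exists2 s : nat -> nat, {homo s : m n / (m < n)%N} &
    exists g : R[i] -> R[i], cvg_compact_uniform (fun n => u (s n)) g.
Proof.
move=> uB uL; have [g gP] := lipschitz_cluster uB uL.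
have /choice[c cP] : forall nN : nat * nat, exists m, (nN.2 <= m)%N /\
    forall z, normc z <= nN.1%:R -> normc (u m z - g z) <= nN.1.+1%:R^-1.
  move=> [n N]; have [|m Nm h] := gP n%:R n.+1%:R^-1 N; last by exists m.
  by rewrite invr_gt0 ltr0n.
(* Term n is within 1 / (n + 1) of [g] on the disc of radius n, so a single subsequence serves every
   compact set. *)
pose s := fix s n := if n is k.+1 then c (n, (s k).+1) else c (0%N, 0%N).
exists s.
  by apply: homo_ltn => [|n]; [exact: ltn_trans | have [] := cP (n.+1, (s n).+1)].
exists g => K /compact_normc_bounded[r Kr] P /uniform_nbhs[E [entE EP]].
move: entE; rewrite -entourage_from_ballE => -[e e0 eE].
have e'0 : 0 < complex.Re e by move: e0; rewrite /= ltcE => /andP[].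
(* The radius of an entourage lives in [R[i]]; being positive there, it is real. *)
have eC : e = (complex.Re e)%:C.
  by move: e0; rewrite /= ltcE => /andP[/eqP]; case: e {eE e'0} => a b /= ->.
pose N := maxn r (Num.truncn (complex.Re e)^-1).
exists N => // n /= Nn; apply: EP => z Kz; apply: eE => /=.
rewrite -ball_normE /= distrC eC ltcR.
have sP : forall z, normc z <= n%:R -> normc (u (s n) z - g z) <= n.+1%:R^-1.
  by case: (n) => [|k]; [have [] := cP (0, 0)%N | have [] := cP (k.+1, (s k).+1)].
apply: le_lt_trans (sP z _) _.
  rewrite (le_trans (Kr z Kz)) // ler_nat (leq_trans _ Nn) //.
  exact: leq_maxl.
rewrite invf_plt ?posrE ?ltr0n //; apply: lt_le_trans (truncnS_gt _) _.
by rewrite ler_nat ltnS (leq_trans _ Nn) // leq_maxr.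
Qed.

End Subsequences.

(** * Standardized characteristic functions *)

Section Conclusion.
Variable R : realType.
Implicit Types (z h : R[i]).

Lemma derivable_quadratic (F : R[i] -> R[i]) z l (C : R) :
  (forall h, normc h <= 1 ->
    normc (F (h + z) - F z - h * l) <= C * normc h ^+ 2) ->
  derivable (F : R[i]^o -> R[i]^o) z 1.
Proof.
move=> hF; apply/cvg_ex; exists l.
apply/(@cvgrPdist_lt _ R[i]^o) => e e0.
have eC : e = (complex.Re e)%:C.
  by move: e0; rewrite ltcE => /andP[/eqP]; case: e => a b /= ->.
have e'0 : 0 < complex.Re e by move: e0; rewrite ltcE => /andP[].
(* The 1 keeps [h] where the remainder estimate holds; [|C| + 1] is positive whatever the sign of
   [C]. *)
pose d := Num.min 1 (complex.Re e / (`|C| + 1)).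
have C0 : 0 < `|C| + 1 by rewrite ltr_pwDr.
have d0 : 0 < d%:C by rewrite ltcR lt_min ltr01 divr_gt0.
near=> h.
have h0 : h != 0 by near: h; exact: nbhs_dnbhs_neq.
have : `|h : R[i]^o| < d%:C by near: h; exact: dnbhs0_lt.
rewrite -[`|h|]/((normc h)%:C) ltcR lt_min => /andP[h1 h2].
have nh0 : 0 < normc h.
  by rewrite lt_neqAle normc_ge0 andbT eq_sym; apply: contra_neq h0 => /eq0_normc.
rewrite -normrN opprB -[X in X < _]/((normc _)%:C) eC ltcR.
have -> : h^-1 *: (F (h *: (1 : R[i]^o) + z) - F z) - l =
    h^-1 * (F (h + z) - F z - h * l).
  rewrite /GRing.scale /= mulr1 [RHS]mulrBr; congr (_ - _).
  by rewrite mulKf.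
rewrite normcM normcV mulrC ltr_pdivrMr //.
apply: le_lt_trans (hF _ (ltW h1)) _; rewrite expr2 mulrA ltr_pM2r //.
rewrite ltr_pdivlMr // in h2; apply: le_lt_trans h2.
rewrite mulrC ler_pM2l //; have := ler_norm C; lra.
Unshelve. all: by end_near. Qed.

(** The functional equation factors out the value at z, leaving the second-order remainder of [cexp]
    at iht. *)
Lemma derivable_cexp_lin (a : R[i]) (t : R) z :
  derivable ((fun z => a * cexp ('i%C * z * t%:C)) : R[i]^o -> R[i]^o) z 1.
Proof.
pose A := a * cexp ('i%C * z * t%:C).
apply: (@derivable_quadratic _ z (A * ('i%C * t%:C))
  (normc A * (4 * `|t| ^+ 2 * expR `|t|))) => h h1.
have -> : a * cexp ('i%C * (h + z) * t%:C) - a * cexp ('i%C * z * t%:C)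
    - h * (A * ('i%C * t%:C)) =
    A * (cexp ('i%C * h * t%:C) - 1 - 'i%C * h * t%:C).
  by rewrite /A mulrDr mulrDl cexpD; ring.
rewrite normcM -[leRHS]mulrA ler_wpM2l ?normc_ge0 //.
apply: le_trans (normc_cexp_sub1D _) _; rewrite normc_iM exprMn.
rewrite [leRHS](_ : _ = 4 * (normc h ^+ 2 * `|t| ^+ 2) * expR `|t|); last by ring.
apply: ler_wpM2l; last by rewrite ler_expR ler_piMl.
by rewrite -exprMn mulr_ge0 ?sqr_ge0.
Qed.

Lemma std_charfun_entire f : entire (std_charfun f : R[i] -> R[i]).
Proof.
have [->|f1] := eqVneq f 1.
  by rewrite /std_charfun eqxx => z; exact: derivable_cst.
rewrite std_charfunE // => z.
have := @derivable_sum R[i] R[i]^o R[i]^o _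
  (fun k : 'I_(size f) => fun z : R[i]^o => (cgf_pmf R f k)%:C
    * cexp ('i%C * z * ((k%:R - cgf_mean R f) / cgf_sd R f)%:C) : R[i]^o) z 1.
rewrite fct_sumE; apply => k; exact: derivable_cexp_lin.
Qed.

Definition charfun_lip (r : R) : R :=
  3 * (mgf_bound (1 + 3 * r) + mgf_bound (- (1 + 3 * r))).

(** Taking [mgf_bound] for the function [E] of [cexp_sum_lipschitz] makes the constant depend on the
    radius alone: this is the equicontinuity of the family. *)
Lemma std_charfun_lipschitz f : Phi_plus f ->
  forall r z w, normc z <= r -> normc w <= r ->
  normc (std_charfun f z - std_charfun f w) <= charfun_lip r * normc (z - w).
Proof.
move=> fP r z w zr wr; have [->|f1] := eqVneq f 1.
  rewrite /std_charfun eqxx subrr normc0 mulr_ge0 ?normc_ge0 //.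
  by rewrite mulr_ge0 // addr_ge0 // expR_ge0.
rewrite !std_charfunE //; apply: cexp_sum_lipschitz => // [k|s].
  exact: cgf_pmf_ge0.
rewrite (eq_bigr _ (fun k _ => mulrC _ _)); exact: cgf_mgf_le.
Qed.

Lemma std_charfun0 f : Phi_plus f -> std_charfun f 0 = 1 :> R[i].
Proof.
move=> fP; have [->|f1] := eqVneq f 1; first by rewrite /std_charfun eqxx.
rewrite std_charfunE // (eq_bigr (fun k : 'I__ => (cgf_pmf R f k)%:C)); last first.
  by move=> k _; rewrite mulr0 mul0r cexp0 mulr1.
rewrite -rmorph_sum /= -mulr_suml sum_coef1 divff //.
exact/lt0r_neq0/Phi_plus_horner1_gt0.
Qed.

End Conclusion.

Theorem theorem5p1 (R : realType) :
  (forall phi, C_CGF R phi -> entire phi) /\ normal_family (C_CGF R).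
Proof.
split=> [phi [f _ <-]|u uC]; first exact: std_charfun_entire.
have uL n r (z w : R[i]) : normc z <= r -> normc w <= r ->
    normc (u n z - u n w) <= charfun_lip r * normc (z - w).
  by have [f fP <-] := uC n; exact: std_charfun_lipschitz.
(* Pointwise boundedness follows from equicontinuity, because every member takes the value 1 at
   0. *)
suff uB n (z : R[i]) :
    normc (u n z) <= charfun_lip (normc z) * normc (z - 0) + 1.
  exact: lipschitz_subsequence uB uL.
have z0 : normc (0 : R[i]) <= normc z by rewrite normc0 normc_ge0.
rewrite -[u n z](subrK (u n 0)); apply: le_trans (normcD _ _) _.
have -> : normc (u n 0) = 1.
  by have [f fP <-] := uC n; rewrite std_charfun0 // normc1.
by rewrite lerD2r; apply: uL.
Qed.
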